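(* Let $H,n,m,q$ be natural numbers, $f:\mathbb{R}^n\times\mathbb{R}^m\to\mathbb{R}^n$, $g:\mathbb{R}^n\times\mathbb{R}^m\to\mathbb{R}^q$, $\bar x\in\mathbb{R}^n$, $Z=[z_0^\top,\ldots,z_H^\top]^\top\in\mathbb{R}^{(H+1)n}$, let $R,R_H\in\mathbb{R}^{n\times n}$ and $Q\in\mathbb{R}^{m\times m}$ be symmetric positive definite, and let $\rho^\ell>0$, $S^\ell\in\mathbb{R}_+^{Hq}$, $Y^\ell\in\mathbb{R}^{Hq}$. With the maps $\mathcal{F}(\bar x,\cdot)$, $\mathcal{G}_{\bar x}$, $\mathcal{J}_{\bar x}$ defined in the context, let $$\Phi^\ell(U):=\mathcal{J}_{\bar x}(U)+\tfrac{\rho^\ell}{2}\big\|\mathcal{G}_{\bar x}(U)+S^\ell+Y^\ell\big\|_2^2,\qquad U\in\mathbb{R}^{Hm},$$ and assume that the set of minimizers of $\Phi^\ell$ over $\mathbb{R}^{Hm}$ is nonempty. Put $y^\ell:=-S^\ell-Y^\ell$ and consider three Gaussian virtual observations $0$, $Z$, $y^\ell$ of the unknown $U$, modelled by $$0=U+\eta_U,\quad \eta_U\sim\mathcal{N}(0,\Sigma_Q);\qquad Z=\mathcal{F}(\bar x,U)+\eta_X,\quad \eta_X\sim\mathcal{N}(0,\Sigma_R);\qquad y^\ell=\mathcal{G}_{\bar x}(U)+\eta_G,\quad \eta_G\sim\mathcal{N}(0,\Sigma_{\rho^\ell}),$$ with $\eta_U,\eta_X,\eta_G$ independent, where $$\Sigma_Q:=I_H\otimes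 Q^{-1},\qquad \Sigma_R:=\operatorname{blkdiag}(I_H\otimes R^{-1},\,R_H^{-1}),\qquad \Sigma_{\rho^\ell}:=\tfrac{1}{\rho^\ell}I_{Hq}.$$ Then the set of maximum a posteriori (MAP) estimators for the posterior $p(U\mid 0,Z,y^\ell)$ coincides with the set of minimizers of $\Phi^\ell$: $$\operatorname*{argmax}_{U\in\mathbb{R}^{Hm}}\,p(U\mid 0,Z,y^\ell)=\operatorname*{argmin}_{U\in\mathbb{R}^{Hm}}\,\Phi^\ell(U).$$
   Context: Rollout map: for $U=[u_0^\top,\ldots,u_{H-1}^\top]^\top\in\mathbb{R}^{Hm}$ (with $u_t\in\mathbb{R}^m$), $\mathcal{F}(\bar x,U):=[x_0^\top,\ldots,x_H^\top]^\top\in\mathbb{R}^{(H+1)n}$, where $x_0=\bar x$ and $x_{t+1}=f(x_t,u_t)$ for $t=0,\ldots,H-1$. Reduced constraint map: $\mathcal{G}_{\bar x}(U):=[g(x_0,u_0)^\top,\ldots,g(x_{H-1},u_{H-1})^\top]^\top\in\mathbb{R}^{Hq}$, where $(x_t)$ is the trajectory $\mathcal{F}(\bar x,U)$. Reduced cost: with $\|v\|_M^2:=v^\top M v$, $$\mathcal{J}_{\bar x}(U):=\tfrac12\sum_{t=0}^{H-1}\big(\|x_t-z_t\|_R^2+\|u_t\|_Q^2\big)+\tfrac12\|x_H-z_H\|_{R_H}^2,$$ where $(x_t)$ is the trajectory $\mathcal{F}(\bar x,U)$. $\mathbb{R}_+^{Hq}$ is the nonnegative orthant, $I_p$ is the $p\times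 p$ identity, $\otimes$ is the Kronecker product, $\operatorname{blkdiag}$ denotes a block-diagonal matrix, and $\mathcal{N}(\mu,\Sigma)$ is the Gaussian distribution with mean $\mu$ and covariance $\Sigma$. Posterior: the posterior density is, up to a positive factor not depending on $U$, the product of the three likelihoods, $p(U\mid 0,Z,y^\ell)\propto p(0\mid U)\,p(Z\mid U)\,p(y^\ell\mid U)$ (that is, no further prior on $U$ is imposed beyond the virtual observation $0=U+\eta_U$). Here $p(0\mid U)$, $p(Z\mid U)$, $p(y^\ell\mid U)$ are the Gaussian densities of $\mathcal{N}(U,\Sigma_Q)$, $\mathcal{N}(\mathcal{F}(\bar x,U),\Sigma_R)$ and $\mathcal{N}(\mathcal{G}_{\bar x}(U),\Sigma_{\rho^\ell})$ evaluated at $0$, $Z$ and $y^\ell$ respectively. A MAP estimator is a (global) maximizer of $U\mapsto p(U\mid 0,Z,y^\ell)$ over $\mathbb{R}^{Hm}$. *)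

(* Defs.v *)
From mathcomp Require Import all_boot all_order all_algebra.
From mathcomp Require Import mxtens.
From mathcomp Require Import all_classical all_reals all_analysis.

Set Implicit Arguments.
Unset Strict Implicit.
Unset Printing Implicit Defensive.

Import Order.TTheory GRing.Theory Num.Theory.
Local Open Scope classical_set_scope.
Local Open Scope ring_scope.

Section LinearAlgebra.
Context {R : realType}.

(* Vectors of R^(k * d) made of k stacked blocks of length d.  The flat index
   of entry j of block i is [mxtens_index (i, j)] = i * d + j, the same layout
   as that of the Kronecker product [*t]. *)
Definition block k d (v : 'cV[R]_(k * d)) (i : 'I_k) : 'cV[R]_d :=
  \col_j v (mxtens_index (i, j)) 0.

Definition stack k d (b : 'I_k -> 'cV[R]_d) : 'cV[R]_(k * d) :=
  \col_l b (mxtens_unindex l).1 (mxtens_unindex l).2 0.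

Definition wnorm2 p (M : 'M[R]_p) (v : 'cV[R]_p) : R := (v^T *m M *m v) 0 0.

(* The squared Euclidean norm; the library norm `|v| on matrices is the
   maximum norm. *)
Definition enorm2 p (v : 'cV[R]_p) : R := \sum_(i < p) v i 0 ^+ 2.

Definition sym_posdef p (M : 'M[R]_p) : Prop :=
  M \is symmetricmx /\ forall v : 'cV[R]_p, v != 0 -> 0 < wnorm2 M v.

(* Density at y of the nondegenerate Gaussian N(mu, Sigma) on R^p. *)
Definition gaussian_pdf p (mu : 'cV[R]_p) (Sigma : 'M[R]_p) (y : 'cV[R]_p) : R :=
  (Num.sqrt ((2 * pi) ^+ p * \det Sigma))^-1 *
  expR (- (2^-1 * wnorm2 (invmx Sigma) (y - mu))).

(* Likelihood of the unknown U for an observation y = h(U) + eta with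
   eta ~ N(0, Sigma): the conditional law of y is N(h(U), Sigma). *)
Definition likelihood p k (h : 'cV[R]_p -> 'cV[R]_k) (Sigma : 'M[R]_k)
  (y : 'cV[R]_k) (U : 'cV[R]_p) : R := gaussian_pdf (h U) Sigma y.

End LinearAlgebra.

Definition argmin {R : realType} {T : Type} (phi : T -> R) : set T :=
  [set u | forall v, phi u <= phi v].

Definition argmax {R : realType} {T : Type} (phi : T -> R) : set T :=
  [set u | forall v, phi v <= phi u].

Section OptimalControl.
Context {R : realType} {H n m q : nat}.
Variables (f : 'cV[R]_n -> 'cV[R]_m -> 'cV[R]_n).
Variables (g : 'cV[R]_n -> 'cV[R]_m -> 'cV[R]_q).
Variable xbar : 'cV[R]_n.

(* The input u_t of the stacked vector U; the value 0 for t >= H is never used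
   by the states x_0, ..., x_H. *)
Definition input (U : 'cV[R]_(H * m)) (t : nat) : 'cV[R]_m :=
  oapp (block U) 0 (insub t).

Fixpoint state (U : 'cV[R]_(H * m)) (t : nat) : 'cV[R]_n :=
  if t is t'.+1 then f (state U t') (input U t') else xbar.

Definition rollout (U : 'cV[R]_(H * m)) : 'cV[R]_(H.+1 * n) :=
  stack (fun t : 'I_H.+1 => state U t).

Definition constraint (U : 'cV[R]_(H * m)) : 'cV[R]_(H * q) :=
  stack (fun t : 'I_H => g (state U t) (block U t)).

Definition cost (Z : 'cV[R]_(H.+1 * n)) (Rx RH : 'M[R]_n) (Q : 'M[R]_m)
    (U : 'cV[R]_(H * m)) : R :=
  2^-1 * \sum_(t < H)
    (wnorm2 Rx (state U t - block Z (widen_ord (leqnSn H) t))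
     + wnorm2 Q (block U t))
  + 2^-1 * wnorm2 RH (state U H - block Z ord_max).

Definition augmented_cost (Z : 'cV[R]_(H.+1 * n)) (Rx RH : 'M[R]_n)
    (Q : 'M[R]_m) (rho : R) (S Y : 'cV[R]_(H * q)) (U : 'cV[R]_(H * m)) : R :=
  cost Z Rx RH Q U + rho / 2 * enorm2 (constraint U + S + Y).

Definition cov_input (Q : 'M[R]_m) : 'M[R]_(H * m) := 1%:M *t invmx Q.

(* blkdiag(I_H (x) Rx^-1, RH^-1), of size H * n + n = H.+1 * n. *)
Definition cov_state (Rx RH : 'M[R]_n) : 'M[R]_(H.+1 * n) :=
  castmx (esym (mulSnr H n), esym (mulSnr H n))
    (block_mx ((1%:M : 'M[R]_H) *t invmx Rx) 0 0 (invmx RH)).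

Definition cov_constraint (rho : R) : 'M[R]_(H * q) := (rho^-1)%:M.

(* p is a version of the posterior p(U | 0, Z, y): up to a positive factor that
   does not depend on U, the product of the three likelihoods. *)
Definition is_posterior (Z : 'cV[R]_(H.+1 * n)) (y : 'cV[R]_(H * q))
    (Rx RH : 'M[R]_n) (Q : 'M[R]_m) (rho : R) (p : 'cV[R]_(H * m) -> R) : Prop :=
  exists2 c : R, 0 < c & forall U,
    p U = c * (likelihood id (cov_input Q) 0 U
               * likelihood rollout (cov_state Rx RH) Z U
               * likelihood constraint (cov_constraint rho) y U).

End OptimalControl.

(* Main.v *)
Require Import Defs.
From mathcomp Require Import all_boot all_order all_algebra.
From mathcomp Require Import mxtens.
From mathcomp Require Import all_classical all_reals all_analysis.
From mathcomp Require Import ring lra.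

Set Implicit Arguments.
Unset Strict Implicit.
Unset Printing Implicit Defensive.

Import Order.TTheory GRing.Theory Num.Theory.
Local Open Scope classical_set_scope.
Local Open Scope ring_scope.

(** The augmented cost is the negative logarithm of the posterior up to an
    additive constant. Each likelihood is a positive constant times [expR] of
    minus half a quadratic form, whose matrix is the inverse of the covariance.
    Inverting the covariances block by block turns these forms into the terms
    of the augmented cost: the input observation gives the [Q]-terms, the state
    observation gives the [Rx]-terms and the terminal [RH]-term, and the
    constraint observation at [- S - Y] gives the penalty
    ([augmented_costE]). Hence the posterior is [c * expR (- Phi)] with [c > 0],
    and since [expR] is increasing, its maximizers are the minimizers of [Phi]
    ([argmax_gibbs]).

    The point that needs an argument is [c > 0]. A Gaussian density is
    normalized by the inverse of [Num.sqrt ((2 * pi) ^+ p * \det Sigma)], and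
    [Num.sqrt] vanishes on nonpositive numbers, so a covariance with
    nonpositive determinant would make the density identically zero. The
    inverse covariances are positive definite, because their quadratic forms
    are sums of positive definite forms of the blocks; and a positive definite
    matrix has a positive determinant ([posdef_det_gt0]). *)

(** * Positive definite quadratic forms *)

Definition posdef (R : realType) p (M : 'M[R]_p) : Prop :=
  forall v : 'cV[R]_p, v != 0 -> 0 < wnorm2 M v.

Section QuadraticForms.
Variable R : realType.

Lemma wnorm20 p (M : 'M[R]_p) : wnorm2 M 0 = 0.
Proof. by rewrite /wnorm2 mulmx0 mxE. Qed.

Lemma wnorm2N p (M : 'M[R]_p) v : wnorm2 M (- v) = wnorm2 M v.
Proof. by rewrite /wnorm2 [(- v)^T]linearN mulmxN !mulNmx opprK. Qed.

Lemma wnorm2E p (M : 'M[R]_p) v :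
  wnorm2 M v = \sum_i \sum_j v i 0 * M i j * v j 0.
Proof.
rewrite /wnorm2 mxE exchange_big /=; apply: eq_bigr => j _.
by rewrite mxE mulr_suml; apply: eq_bigr => i _; rewrite mxE.
Qed.

Lemma wnorm2_subC p (M : 'M[R]_p) u v : wnorm2 M (u - v) = wnorm2 M (v - u).
Proof. by rewrite -wnorm2N opprB. Qed.

Lemma wnorm2D p (A B : 'M[R]_p) v :
  wnorm2 (A + B) v = wnorm2 A v + wnorm2 B v.
Proof. by rewrite /wnorm2 mulmxDr mulmxDl mxE. Qed.

Lemma wnorm2Z p (a : R) (A : 'M[R]_p) v : wnorm2 (a *: A) v = a * wnorm2 A v.
Proof. by rewrite /wnorm2 -scalemxAr -scalemxAl mxE. Qed.

Lemma wnorm2_scalar p (a : R) (v : 'cV[R]_p) : wnorm2 a%:M v = a * enorm2 v.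
Proof.
rewrite /wnorm2 mul_mx_scalar -scalemxAl !mxE; congr (_ * _).
by apply: eq_bigr => i _; rewrite mxE expr2.
Qed.

Lemma enorm2_gt0 p (v : 'cV[R]_p) : v != 0 -> 0 < enorm2 v.
Proof.
move=> v0; rewrite lt_def sumr_ge0 ?andbT => [|i _]; last exact: sqr_ge0.
apply: contra v0; rewrite psumr_eq0 => [|i _]; last exact: sqr_ge0.
move=> /allP v0; apply/eqP/matrixP => i j; rewrite ord1 mxE.
by have := v0 i (mem_index_enum _); rewrite sqrf_eq0 => /eqP.
Qed.

Lemma posdef_ge0 p (M : 'M[R]_p) v : posdef M -> 0 <= wnorm2 M v.
Proof.
by move=> hM; have [->|/hM/ltW//] := eqVneq v 0; rewrite wnorm20.
Qed.

Lemma posdef_scalar p (a : R) : 0 < a -> posdef (a%:M : 'M[R]_p).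
Proof. by move=> a0 v v0; rewrite wnorm2_scalar mulr_gt0 ?enorm2_gt0. Qed.

Lemma posdef_convex p (A B : 'M[R]_p) (t : R) :
  0 <= t <= 1 -> posdef A -> posdef B -> posdef (t *: A + (1 - t) *: B).
Proof.
move=> /andP[t0 t1] hA hB v v0; rewrite wnorm2D !wnorm2Z.
have := hA v v0; have := hB v v0; nra.
Qed.

Lemma posdef_det_neq0 p (M : 'M[R]_p) : posdef M -> \det M != 0.
Proof.
move=> hM; apply/negP => /det0P [v v0 vM].
have /hM : v^T != 0 by rewrite -trmx0 (inj_eq trmx_inj).
by rewrite /wnorm2 trmxK vM mul0mx mxE ltxx.
Qed.

(** On the segment from the identity to [M] all matrices are positive definite,
    so the determinant, a polynomial in the parameter, has no root there. It
    is 1 at the identity, hence positive at [M] by the intermediate value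
    theorem. *)
Lemma posdef_det_gt0 p (M : 'M[R]_p) : posdef M -> 0 < \det M.
Proof.
move=> hM.
pose P := \det ('X *: map_mx polyC M + (1 - 'X) *: 1%:M).
have PE t : P.[t] = \det (t *: M + (1 - t) *: 1%:M).
  rewrite /P -horner_evalE -det_map_mx; congr (\det _).
  by apply/matrixP => i j; rewrite !mxE /= -polyC_natr horner_evalE !hornerE.
have P1 : P.[1] = \det M by rewrite PE subrr scale0r addr0 scale1r.
have P0 : P.[0] = 1 by rewrite PE subr0 scale0r add0r scale1r det1.
rewrite ltNge; apply/negP => M0.
(* The sign of [P] is changed because [poly_ivt] wants it to go from
   nonpositive to nonnegative. *)
have [t t01 rt] : exists2 t, 0 <= t <= 1 & root (- P) t.
  by apply: poly_ivt; rewrite ?ler01 // !hornerN P0 P1 oppr_le0 oppr_ge0 ler01.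
move: rt; rewrite rootN /root PE; apply/negP/posdef_det_neq0.
by apply: posdef_convex => //; apply: posdef_scalar; rewrite ltr01.
Qed.

Lemma posdef_unitmx p (M : 'M[R]_p) : posdef M -> M \in unitmx.
Proof. by move=> /posdef_det_neq0; rewrite unitmxE unitfE. Qed.

End QuadraticForms.

(** * Block-diagonal matrices *)

Section BlockDiagonal.
Variable R : realType.

Lemma block_stack k d (b : 'I_k -> 'cV[R]_d) i : block (stack b) i = b i.
Proof.
by apply/matrixP => j l; rewrite ord1 !mxE mxtens_indexK.
Qed.

Lemma blockB k d (u v : 'cV[R]_(k * d)) i :
  block (u - v) i = block u i - block v i.
Proof. by apply/matrixP => j l; rewrite !mxE. Qed.

Lemma block_eq0 k d (v : 'cV[R]_(k * d)) : (forall i, block v i = 0) -> v = 0.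
Proof.
move=> v0; apply/matrixP => l j; rewrite ord1 mxE.
case: (mxtens_indexP l) => i i'.
by have /matrixP/(_ i' 0) := v0 i; rewrite !mxE.
Qed.

Lemma wnorm2_castmx p p' (e : p = p') (M : 'M[R]_p) v :
  wnorm2 (castmx (e, e) M) v = wnorm2 M (castmx (esym e, erefl) v).
Proof. by case: _ / e v => v; rewrite !castmx_id. Qed.

Lemma big_mxtens_index k d (F : 'I_(k * d) -> R) :
  \sum_l F l = \sum_i \sum_j F (mxtens_index (i, j)).
Proof.
rewrite pair_big /= (reindex (@mxtens_index k d)) /=.
  by apply: eq_bigr => -[].
by exists (@mxtens_unindex k d) => i _;
   rewrite (mxtens_indexK, mxtens_unindexK).
Qed.

Lemma wnorm2_tens1 k d (M : 'M[R]_d) (v : 'cV[R]_(k * d)) :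
  wnorm2 (1%:M *t M) v = \sum_i wnorm2 M (block v i).
Proof.
rewrite wnorm2E big_mxtens_index; apply: eq_bigr => i _.
rewrite wnorm2E; apply: eq_bigr => j _.
rewrite big_mxtens_index (bigD1 i) //= [X in _ + X]big1 ?addr0; last first.
  move=> i' ii'; apply: big1 => j' _.
  by rewrite tensmxE !mxE eq_sym (negPf ii') mul0r mulr0 mul0r.
by apply: eq_bigr => j' _; rewrite tensmxE !mxE eqxx mul1r.
Qed.

Lemma wnorm2_block_diag p1 p2 (A : 'M[R]_p1) (B : 'M[R]_p2) v :
  wnorm2 (block_mx A 0 0 B) v = wnorm2 A (usubmx v) + wnorm2 B (dsubmx v).
Proof.
rewrite /wnorm2 -{1 2}[v]vsubmxK tr_col_mx mul_row_block !mulmx0 addr0 add0r.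
by rewrite mul_row_col mxE.
Qed.

Lemma posdef_tens1 k d (M : 'M[R]_d) :
  posdef M -> posdef ((1%:M : 'M[R]_k) *t M).
Proof.
move=> hM v v0; rewrite wnorm2_tens1 lt_def sumr_ge0 ?andbT => [|i _];
  last exact: posdef_ge0.
apply: contra v0; rewrite psumr_eq0 => [/allP v0|i _]; last exact: posdef_ge0.
apply/eqP/block_eq0 => i; apply: contraTeq (v0 i (mem_index_enum _)) => /hM.
by rewrite lt0r => /andP[].
Qed.

Lemma posdef_block_diag p1 p2 (A : 'M[R]_p1) (B : 'M[R]_p2) :
  posdef A -> posdef B -> posdef (block_mx A 0 0 B).
Proof.
move=> hA hB v v0; rewrite wnorm2_block_diag.
have [u0|/hA hu] := eqVneq (usubmx v) 0; last first.
  by rewrite ltr_pwDl ?posdef_ge0.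
have [d0|/hB hd] := eqVneq (dsubmx v) 0; last first.
  by rewrite ltr_wpDl ?posdef_ge0.
by move: v0; rewrite -[v]vsubmxK u0 d0 col_mx0 eqxx.
Qed.

Lemma posdef_castmx p p' (e : p = p') (M : 'M[R]_p) :
  posdef M -> posdef (castmx (e, e) M).
Proof. by case: _ / e; rewrite castmx_id. Qed.

Lemma invmx_castmx p p' (e : p = p') (M : 'M[R]_p) :
  invmx (castmx (e, e) M) = castmx (e, e) (invmx M).
Proof. by case: _ / e; rewrite !castmx_id. Qed.

Lemma tens_mx11 k d : (1%:M : 'M[R]_k) *t (1%:M : 'M[R]_d) = 1%:M.
Proof.
apply/matrixP => i j.
case: (mxtens_indexP i) => i0 i1; case: (mxtens_indexP j) => j0 j1.
rewrite tensmxE !mxE (inj_eq (can_inj (@mxtens_indexK k d))) xpair_eqE.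
by rewrite -natrM mulnb.
Qed.

Lemma invmx_tens1 k d (M : 'M[R]_d) : M \in unitmx ->
  invmx ((1%:M : 'M[R]_k) *t M) = 1%:M *t invmx M.
Proof.
move=> uM.
have e : ((1%:M : 'M[R]_k) *t M) *m (1%:M *t invmx M) = 1%:M.
  by rewrite tensmx_mul mulmx1 mulmxV // tens_mx11.
have [u _] := mulmx1_unit e.
by rewrite -[RHS](mulKmx u) e mulmx1.
Qed.

End BlockDiagonal.

(** * Inverse covariances of the virtual observations *)

Section Covariances.
Variable R : realType.

Lemma invmx_cov_input H m (Q : 'M[R]_m) : posdef Q ->
  invmx (cov_input (H := H) Q) = 1%:M *t Q.
Proof.
by move=> hQ; rewrite invmx_tens1 ?invmxK // unitmx_inv posdef_unitmx.
Qed.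

Lemma invmx_cov_state H n (Rx RH : 'M[R]_n) : posdef Rx -> posdef RH ->
  invmx (cov_state (H := H) Rx RH) =
  castmx (esym (mulSnr H n), esym (mulSnr H n))
    (block_mx ((1%:M : 'M[R]_H) *t Rx) 0 0 RH).
Proof.
move=> hRx hRH; rewrite invmx_castmx; congr (castmx _ _).
apply: (canLR invmxK).
have uD : block_mx ((1%:M : 'M[R]_H) *t Rx) 0 0 RH \in unitmx.
  by apply/posdef_unitmx/posdef_block_diag => //; apply: posdef_tens1.
by rewrite invmx_block_diag // invmx_tens1 // posdef_unitmx.
Qed.

Lemma posdef_invmx_cov_input H m (Q : 'M[R]_m) : posdef Q ->
  posdef (invmx (cov_input (H := H) Q)).
Proof. by move=> hQ; rewrite invmx_cov_input //; apply: posdef_tens1. Qed.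

Lemma posdef_invmx_cov_state H n (Rx RH : 'M[R]_n) : posdef Rx -> posdef RH ->
  posdef (invmx (cov_state (H := H) Rx RH)).
Proof.
move=> hRx hRH; rewrite invmx_cov_state //.
by apply/posdef_castmx/posdef_block_diag => //; apply: posdef_tens1.
Qed.

Lemma invmx_cov_constraint H q (rho : R) :
  invmx (cov_constraint (H := H) (q := q) rho) = rho%:M.
Proof. by rewrite invmx_scalar invrK. Qed.

Lemma wnorm2_cov_state H n (Rx RH : 'M[R]_n) (v : 'cV[R]_(H.+1 * n)) :
  posdef Rx -> posdef RH ->
  wnorm2 (invmx (cov_state (H := H) Rx RH)) v =
  \sum_(t < H) wnorm2 Rx (block v (widen_ord (leqnSn H) t))
  + wnorm2 RH (block v ord_max).
Proof.
move=> hRx hRH; rewrite invmx_cov_state // wnorm2_castmx wnorm2_block_diag.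
rewrite wnorm2_tens1; congr (_ + _).
  apply: eq_bigr => t _; congr (wnorm2 _ _).
  apply/matrixP => i j; rewrite !mxE castmxE; congr (v _ _); exact: val_inj.
(* The last block and the lower part both start at flat index [H * n]. *)
congr (wnorm2 _ _).
apply/matrixP => i j; rewrite !mxE castmxE; congr (v _ _).
  by apply: val_inj.
by rewrite !ord1.
Qed.

Lemma posdef_invmx_cov_constraint H q (rho : R) : 0 < rho ->
  posdef (invmx (cov_constraint (H := H) (q := q) rho)).
Proof. by rewrite invmx_cov_constraint; apply: posdef_scalar. Qed.

End Covariances.

(** * Negative log-likelihoods *)

Section Likelihoods.
Variable R : realType.

(** Stated on the inverse covariance, the matrix that is known explicitly
    here: its determinant has the sign of the determinant of [Sigma]. *)
Lemma gaussian_pdf_kernel p (Sigma : 'M[R]_p) : posdef (invmx Sigma) ->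
  exists2 k, 0 < k & forall mu y,
    gaussian_pdf mu Sigma y =
    k * expR (- (2^-1 * wnorm2 (invmx Sigma) (y - mu))).
Proof.
move=> /posdef_det_gt0; rewrite det_inv invr_gt0 => dS.
exists (Num.sqrt ((2 * pi) ^+ p * \det Sigma))^-1 => //.
by rewrite invr_gt0 sqrtr_gt0 mulr_gt0 // exprn_gt0 // mulr_gt0 // pi_gt0.
Qed.

Lemma argmax_gibbs (T : Type) (p phi : T -> R) (c : R) : 0 < c ->
  (forall u, p u = c * expR (- phi u)) -> argmax p = argmin phi.
Proof.
move=> c0 pE; apply/seteqP; split => u hu v; have := hu v;
by rewrite !pE ler_pM2l // ler_expR lerN2.
Qed.

(** The three summands are the exponents of the Gaussian densities of the
    observations [0], [Z] and [- S - Y], with their signs changed. *)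
Lemma augmented_costE H n m q (f : 'cV[R]_n -> 'cV[R]_m -> 'cV[R]_n)
    (g : 'cV[R]_n -> 'cV[R]_m -> 'cV[R]_q) xbar (Z : 'cV[R]_(H.+1 * n))
    (Rx RH : 'M[R]_n) (Q : 'M[R]_m) (rho : R) (S Y : 'cV[R]_(H * q)) U :
  posdef Rx -> posdef RH -> posdef Q ->
  augmented_cost f g xbar Z Rx RH Q rho S Y U =
    2^-1 * wnorm2 (invmx (cov_input Q)) (0 - U)
    + 2^-1 * wnorm2 (invmx (cov_state Rx RH)) (Z - rollout f xbar U)
    + 2^-1 * wnorm2 (invmx (cov_constraint rho))
               (- S - Y - constraint f g xbar U).
Proof.
move=> hRx hRH hQ; rewrite /augmented_cost /cost.
rewrite sub0r wnorm2N invmx_cov_input // wnorm2_tens1.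
rewrite [wnorm2 _ (Z - _)]wnorm2_subC wnorm2_cov_state // blockB block_stack.
under [X in _ = _ + _ * (X + _) + _]eq_bigr do rewrite blockB block_stack.
rewrite [wnorm2 _ (- S - Y - _)]wnorm2_subC invmx_cov_constraint wnorm2_scalar.
rewrite -[- S - Y]opprD opprK addrA.
by rewrite big_split /=; field.
Qed.

End Likelihoods.

Theorem proposition1 (R : realType) (H n m q : nat)
    (f : 'cV[R]_n -> 'cV[R]_m -> 'cV[R]_n)
    (g : 'cV[R]_n -> 'cV[R]_m -> 'cV[R]_q)
    (xbar : 'cV[R]_n) (Z : 'cV[R]_(H.+1 * n))
    (Rx RH : 'M[R]_n) (Q : 'M[R]_m)
    (hRx : sym_posdef Rx) (hRH : sym_posdef RH) (hQ : sym_posdef Q)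
    (rho : R) (hrho : 0 < rho)
    (S Y : 'cV[R]_(H * q)) (hS : forall i, 0 <= S i 0)
    (hne : argmin (augmented_cost f g xbar Z Rx RH Q rho S Y) !=set0)
    (p : 'cV[R]_(H * m) -> R)
    (hp : is_posterior f g xbar Z (- S - Y) Rx RH Q rho p) :
  argmax p = argmin (augmented_cost f g xbar Z Rx RH Q rho S Y).
Proof.
case: hRx hRH hQ hp => _ hRx [_ hRH] [_ hQ] [c c0 pE].
have [kQ kQ0 QE] := gaussian_pdf_kernel (posdef_invmx_cov_input (H := H) hQ).
have [kR kR0 RE] :=
  gaussian_pdf_kernel (posdef_invmx_cov_state (H := H) hRx hRH).
have [kG kG0 GE] :=
  gaussian_pdf_kernel (posdef_invmx_cov_constraint (H := H) (q := q) hrho).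
apply: (argmax_gibbs (mulr_gt0 c0 (mulr_gt0 (mulr_gt0 kQ0 kR0) kG0))) => U.
rewrite pE /likelihood QE RE GE augmented_costE // !opprD !expRD; ring.
Qed.
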